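(* Let $E,F$ be metric spaces and equip the product $E \times F$ with any suitable product metric. For any $\theta \in (0,1)$ we have \[ \dim_\mathrm{ML}^{\theta}E + \dim_\mathrm{A}^{\theta}F \leq \dim_\mathrm{A}^{\theta}(E \times F)\leq \dim_\mathrm{A}^{\theta}E+\dim_\mathrm{A}^{\theta}F, \] \[ \dim_\mathrm{L}^{\theta}E + \dim_\mathrm{L}^{\theta}F \leq \dim_\mathrm{L}^{\theta}(E \times F)\leq \dim_\mathrm{L}^{\theta}E+\dim_\mathrm{A}^{\theta}F \] and \[ \dim_\mathrm{ML}^{\theta}E + \dim_\mathrm{ML}^{\theta}F \leq \dim_\mathrm{ML}^{\theta}(E \times F)\leq \dim_\mathrm{ML}^{\theta}E+\dim_\mathrm{A}^{\theta}F. \]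
   Context: Suitable product metrics: for metric spaces $(X,d_X)$ and $(Y,d_Y)$, a natural choice of product metric is the sup metric on $X\times Y$, $d_{X\times Y}((x_1,y_1),(x_2,y_2))=\max\{d_X(x_1,x_2),d_Y(y_1,y_2)\}$; it is compatible with the product topology and bi-Lipschitz equivalent to many other commonly used product metrics, such as those induced by $p$ norms. ''Suitable'' means the sup metric or a product metric bi-Lipschitz equivalent to it. For a subset $E$ of a metric space and $r>0$, $N(E,r)$ denotes the minimal number of balls of radius $r$ required to cover $E$, and $B(x,R)$ is the ball of radius $R$ centred at $x$. For $\theta\in(0,1)$, the Assouad spectrum of a set $F$ at $\theta$ is \[ \dim_{\mathrm A}^{\theta} F = \inf\Big\{\alpha : \exists C>0,\ \exists \rho>0,\ \forall\, 0<R\leq\rho,\ \forall x\in F,\ N(B(x,R)\cap F,R^{1/\theta})\leq C \big(R/R^{1/\theta}\big)^{\alpha}\Big\}, \] the lower spectrum is \[ \dim_{\mathrm L}^{\theta} F = \sup\Big\{\alpha : \exists C>0,\ \exists \rho>0,\ \forall\, 0<R\leq\rho,\ \forall x\in F,\ N(B(x,R)\cap F,R^{1/\theta})\geq C \big(R/R^{1/\theta}\big)^{\alpha}\Big\}, \] and the modified lower spectrum is $\dim_{\mathrm{ML}}^{\theta}F=\sup\{\dim_{\mathrm L}^{\theta}E : \emptyset\neq E\subseteq F\}$.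
   Formalization: E and F are assumed nonempty and weakly doubling (for every e>0, balls of radius 2r are covered by at most C r^(-e) balls of radius r for all small r), as holds in every doubling space; for arbitrary metric spaces the claim fails for some suitable product metrics. *)

(* Defs.v *)
From HB Require Import structures.
From mathcomp Require Import all_boot all_order all_algebra.
From mathcomp Require Import all_classical all_reals all_analysis.

Set Implicit Arguments.
Unset Strict Implicit.
Unset Printing Implicit Defensive.

Import Order.TTheory GRing.Theory Num.Theory.

Local Open Scope classical_set_scope.
Local Open Scope ring_scope.

Section Spectra.
Context {R : realType} {X : metricType R}.
Implicit Types (A F : set X) (r theta : R).

(* Balls are the open balls of [X] and their centres range over all of [X];
   the value is [+oo] when no finite cover exists. *)
Definition covering_number A r : \bar R :=
  ereal_inf [set (n%:R)%:E | n in
    [set n : nat | exists c : 'I_n -> X,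
       A `<=` [set y | exists i, ball (c i) r y]]].

(* [theta] is meant to range over (0, 1). The infimum and the suprema below
   are taken in the extended reals, so that spaces of infinite dimension are
   allowed. *)
Definition assouad_spectrum theta F : \bar R :=
  ereal_inf [set alpha%:E | alpha in
    [set alpha : R | exists C rho : R, [/\ 0 < C, 0 < rho &
      forall r, 0 < r <= rho -> forall x, F x ->
        (covering_number (ball x r `&` F) (r `^ theta^-1)
         <= (C * (r / r `^ theta^-1) `^ alpha)%:E)%E]]].

Definition lower_spectrum theta F : \bar R :=
  ereal_sup [set alpha%:E | alpha in
    [set alpha : R | exists C rho : R, [/\ 0 < C, 0 < rho &
      forall r, 0 < r <= rho -> forall x, F x ->
        ((C * (r / r `^ theta^-1) `^ alpha)%:E
         <= covering_number (ball x r `&` F) (r `^ theta^-1))%E]]].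

Definition modified_lower_spectrum theta F : \bar R :=
  ereal_sup [set lower_spectrum theta E | E in
    [set E : set X | E !=set0 /\ E `<=` F]].

End Spectra.

(* The number of [r]-balls needed to cover a [2r]-ball grows slower than every
   power of [1 / r] as [r] tends to [0]. This holds in every doubling space (see
   [doubling_weakly_doubling]). Some such condition is needed for the spectra to
   be insensitive to constant factors in the radii: without it they can change
   when the metric is multiplied by a constant. *)
Definition weakly_doubling {R : realType} (X : metricType R) : Prop :=
  forall e : R, 0 < e -> exists C rho : R, [/\ 0 < C, 0 < rho &
    forall r : R, 0 < r <= rho -> forall x : X,
      (covering_number (ball x (2 * r)) r <= (C * r `^ (- e))%:E)%E].

Definition doubling {R : realType} (X : metricType R) : Prop :=
  exists M : nat, forall (r : R) (x : X), 0 < r ->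
    (covering_number (ball x (2 * r)) r <= (M%:R)%:E)%E.

Lemma doubling_weakly_doubling {R : realType} (X : metricType R) :
  doubling X -> weakly_doubling X.
Proof.
move=> [M HM] e e0; exists M.+1%:R, 1; split; [by rewrite ltr0n|by []|].
move=> r /andP[r0 r1] x; apply: (le_trans (HM _ _ r0)).
rewrite lee_fin (@le_trans _ _ M.+1%:R)//; first by rewrite ler_nat.
rewrite ler_peMr ?ler0n// powRN -[leLHS]invr1 lef_pV2 ?posrE ?powR_gt0//.
by rewrite -(powRr0 r) ger_powR ?r0//= ltW.
Qed.

Definition sup_dist {R : realType} {E F : metricType R} (p q : E * F) : R :=
  Num.max (mdist p.1 q.1) (mdist p.2 q.2).

Record suitable_product_metric {R : realType} {E F : metricType R}
    (d : E * F -> E * F -> R) : Prop := SuitableProductMetric {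
  spm_refl : forall p, d p p = 0 ;
  spm_positivity : forall p q, d p q = 0 -> p = q ;
  spm_sym : forall p q, d p q = d q p ;
  spm_triangle : forall q p s, d p s <= d p q + d q s ;
  spm_bilipschitz : exists2 c : R, 0 < c &
    forall p q, c^-1 * sup_dist p q <= d p q <= c * sup_dist p q }.

Lemma sup_dist_suitable {R : realType} (E F : metricType R) :
  suitable_product_metric (@sup_dist R E F).
Proof.
split.
- by move=> p; rewrite /sup_dist !mdistxx maxxx.
- move=> [a b] [a' b'] /= h.
  have : sup_dist (a, b) (a', b') <= 0 by rewrite h.
  rewrite /sup_dist ge_max /= => /andP[h1 h2].
  by congr (_, _); apply: mdist_positivity; apply/eqP;
    rewrite eq_le mdist_ge0 ?h1 ?h2.
- by move=> p q; rewrite /sup_dist metric_sym [X in Num.max _ X]metric_sym.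
- move=> q p s; rewrite /sup_dist ge_max; apply/andP; split.
    by rewrite (le_trans (metric_triangle _ q.1 _))// lerD// le_max lexx.
  by rewrite (le_trans (metric_triangle _ q.2 _))// lerD// le_max lexx orbT.
- by exists 1 => // p q; rewrite invr1 !mul1r lexx.
Qed.

(* [E * F] with the metric [d]. The alias is needed because the plain product
   type already carries a pseudometric structure in the library. *)
Definition metric_prod {R : realType} {E F : metricType R}
  (d : E * F -> E * F -> R) (hd : suitable_product_metric d) : Type :=
  (E * F)%type.

HB.instance Definition _ {R : realType} {E F : metricType R}
    (d : E * F -> E * F -> R) (hd : suitable_product_metric d) :=
  Choice.copy (metric_prod hd) (E * F)%type.

HB.instance Definition _ {R : realType} {E F : metricType R}
    (d : E * F -> E * F -> R) (hd : suitable_product_metric d) :=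
  @isMetric.Build R (metric_prod hd) d (spm_refl hd) (spm_positivity hd)
    (spm_sym hd) (spm_triangle hd).

(* Main.v *)
Require Import Defs.
From mathcomp Require Import all_boot all_order all_algebra.
From mathcomp Require Import ring lra.
From mathcomp Require Import all_classical all_reals all_analysis.

Import Order.TTheory GRing.Theory Num.Theory.
Local Open Scope classical_set_scope.
Local Open Scope ring_scope.

(** Write [s = r / r ^ (1 / theta)]. A real [alpha] is an upper (lower) exponent
    of a set [A] when covering the part of [A] in an [r]-ball by balls of radius
    [r ^ (1 / theta)] takes at most (at least) about [s ^ alpha] balls. The
    Assouad spectrum is the infimum of the upper exponents of [A], the lower
    spectrum the supremum of its lower exponents, and the modified lower
    spectrum the supremum of the lower exponents of its nonempty subsets.

    All six inequalities come from two comparisons of covering numbers. Products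
    of balls give [N (A x B, u) <= N (A, u) * N (B, u)] ([covers_product]). For
    the other direction, [N (A, 2 u) * N (B, u) <= N (A x B, u)] is a greedy
    argument ([covers_factor]): the balls of a cover of [A x B] that meet the
    fibre above one point [x] already cover [B], so there are at least [N (B, u)]
    of them, and the remaining balls still cover the part of the product above
    the points of [A] at distance at least [2 u] from [x].

    Since each inequality relates three covering numbers, an exponent for one
    of the sets follows from exponents for the other two:
    - upper exponents of [A] and [B] add up to one of [A x B];
    - lower exponents of [A] and [B] add up to one of [A x B];
    - a lower exponent of [W], minus an upper one of [B], is a lower exponent
      of the projection of [W] to the first factor, for any [W] inside [E x B];
    - an upper exponent of [A x B], minus a lower one of a nonempty [A], is an
      upper exponent of [B].
    The third statement, for arbitrary [W], is what bounds the modified lower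
    spectrum of the product from above.

    The bi-Lipschitz constant of the product metric and the factor [2] above
    change the radii of the balls by constant factors, so exponents are defined
    with two free factors [a] and [b], one for each radius. A factor in the outer
    radius is absorbed by a substitution in [r], which turns it into a factor in
    the inner radius. By weak doubling, a factor in the inner radius [u] costs
    only [u ^ (- e')] for an arbitrarily small [e'], which is a small power of
    [s] ([cover_radius_powR]). Hence the factors can be changed at the price of
    an arbitrarily small change of the exponent ([exponent_above_rescale],
    [exponent_below_rescale]), which the infimum and the suprema do not see. *)

(** * Finite covers and covering numbers *)

Section Covers.
Set Implicit Arguments.
Unset Strict Implicit.
Context {R : realType} {X : metricType R}.
Implicit Types (A B : set X) (r e x : R) (n m k : nat).

(** The number of balls is only bounded by [n], and the centres are listed
    rather than indexed: covers then combine by list operations, and the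
    predicate is monotone in [n]. *)
Definition covers A r n : Prop :=
  exists2 s : seq X, (size s <= n)%N &
    forall y, A y -> exists2 c, c \in s & ball c r y.

Lemma covers_family A r n : covers A r n ->
  exists2 k, (k <= n)%N &
    exists c : 'I_k -> X, A `<=` [set y | exists i, ball (c i) r y].
Proof.
move=> [s sn As]; exists (size s) => //.
exists (tnth (in_tuple s)) => y /As[c].
by move=> /(@tnthP _ _ (in_tuple s))[i ->] cy; exists i.
Qed.

Lemma family_covers A r n (c : 'I_n -> X) :
  A `<=` [set y | exists i, ball (c i) r y] -> covers A r n.
Proof.
move=> Ac; exists (codom c); first by rewrite size_codom card_ord.
by move=> y /Ac[i ciy]; exists (c i) => //; exact: codom_f.
Qed.

Lemma le_covering_numberP A r x :
  (x%:E <= covering_number A r)%E <-> forall n, covers A r n -> x <= n%:R.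
Proof.
split=> [/ereal_infP xA n /covers_family[k kn Ak]|xA].
  rewrite (@le_trans _ _ k%:R) ?ler_nat// -lee_fin; apply: xA.
  by exists k.
apply/ereal_infP => _ [n [c Ac] <-]; rewrite lee_fin.
exact: xA (family_covers Ac).
Qed.

(** The infimum is attained because it runs over natural numbers. *)
Lemma covering_number_leP A r x :
  (covering_number A r <= x%:E)%E <-> exists2 n, covers A r n & n%:R <= x.
Proof.
split=> [Ax|[n /covers_family[k kn Ak] nx]]; last first.
  apply: ge_ereal_inf; exists (k%:R)%:E; first by exists k.
  by rewrite lee_fin (le_trans _ nx)// ler_nat.
have ex_cover : exists n, `[< covers A r n >].
  have /ereal_inf_lt[_ [n [c Ac] _] _] : (covering_number A r < +oo)%E.
    by rewrite (le_lt_trans Ax)// ltry.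
  by exists n; apply/asboolP; exact: family_covers Ac.
case: (ex_minnP ex_cover) => m /asboolP Am m_min; exists m => //.
rewrite -lee_fin (le_trans _ Ax)//; apply/le_covering_numberP => n An.
by rewrite ler_nat m_min//; exact/asboolP.
Qed.

Lemma covers_gt0 A r n (x : X) : A x -> covers A r n -> (0 < n)%N.
Proof.
by move=> Ax [[|c s] sn /(_ x Ax)[]]//; move: sn => /(leq_trans _)->.
Qed.

Lemma covers_radius A r r' n : r <= r' -> covers A r n -> covers A r' n.
Proof.
move=> rr' [s sn As]; exists s => // y /As[c cs cy].
by exists c => //; exact: le_ball cy.
Qed.

Lemma covers_refine_ball A r r' x n : 0 <= x ->
  (forall y, exists2 k, covers (ball y r') r k & k%:R <= x) ->
  covers A r' n -> exists2 m, covers A r m & m%:R <= n%:R * x.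
Proof.
move=> x0 ball_cover [s sn As].
have /choice[f fP] y : exists t : seq X, (size t)%:R <= x /\
    forall z, ball y r' z -> exists2 c, c \in t & ball c r z.
  have [k [t tk yt] kx] := ball_cover y; exists t; split=> //.
  by rewrite (le_trans _ kx)// ler_nat.
exists (size (flatten (map f s))).
  exists (flatten (map f s)) => // y /As[c cs /(fP c).2[b bc by_]].
  by exists b => //; apply/flatten_mapP; exists c.
rewrite (@le_trans _ _ ((size s)%:R * x))//; last first.
  by rewrite ler_wpM2r// ler_nat.
elim: s {sn As} => [|c s IHs] /=; first by rewrite mul0r.
by rewrite size_cat natrD -nat1r mulrDl mul1r lerD// (fP c).1.
Qed.

End Covers.

(** * Changing the radius in a weakly doubling space *)

Section Doubling.
Set Implicit Arguments.
Unset Strict Implicit.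
Context {R : realType} {X : metricType R}.
Implicit Types (A : set X) (r e : R) (n m k : nat).

(** Each of the [j] halvings of the radius costs a small power of [1 / r];
    halving [e] at every step keeps the total cost below [r ^ (- e)]. *)
Lemma covers_refine_exp2 j e : weakly_doubling X -> 0 < e ->
  exists C rho : R, [/\ 0 < C, 0 < rho & forall r, 0 < r <= rho ->
    forall A n, covers A (2 ^+ j * r) n ->
    exists2 m, covers A r m & m%:R <= n%:R * (C * r `^ (- e))].
Proof.
move=> dX; elim: j e => [|j IHj] e e0.
  exists 1, 1; split=> // r /andP[r0 r1] A n; rewrite expr0 mul1r => An.
  exists n => //; rewrite ler_peMr// mul1r powRN -[leLHS]invr1.
  by rewrite lef_pV2 ?posrE ?powR_gt0// -(powRr0 r) ger_powR ?r0// ltW.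
have e20 : 0 < e / 2 by rewrite divr_gt0.
have [C1 [rho1 [C10 rho10 H1]]] := IHj _ e20.
have [C2 [rho2 [C20 rho20 H2]]] := dX _ e20.
exists (C1 * C2), (Num.min (rho1 / 2) rho2); split.
- by rewrite mulr_gt0.
- by rewrite lt_min divr_gt0.
move=> r; rewrite le_min => /andP[r0 /andP[r1 r2]] A n.
rewrite exprSr -mulrA => An.
have rr : 0 < 2 * r <= rho1 by rewrite mulr_gt0//= mulrC -ler_pdivlMr.
have [m Am mn] := H1 _ rr _ _ An.
have [k Ak km] : exists2 k, covers A r k &
    k%:R <= m%:R * (C2 * r `^ (- (e / 2))).
  apply: covers_refine_ball Am; first by rewrite mulr_ge0 ?powR_ge0 ?ltW.
  by move=> y; apply/covering_number_leP/H2; rewrite r0.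
exists k => //; rewrite (le_trans km)//.
have -> : r `^ (- e) = r `^ (- (e / 2)) * r `^ (- (e / 2)).
  rewrite -powRD; last by rewrite (gt_eqF r0) implybT.
  by congr (_ `^ _); field.
rewrite [leRHS](_ : _ =
  n%:R * (C1 * r `^ (- (e / 2))) * (C2 * r `^ (- (e / 2)))).
  rewrite ler_wpM2r ?mulr_ge0 ?powR_ge0 ?(ltW C20)//.
  rewrite (le_trans mn)// ler_wpM2l// ler_wpM2l ?(ltW C10)// !powRN.
  rewrite lef_pV2 ?posrE ?powR_gt0 ?mulr_gt0//.
  by apply: ge0_ler_powR; rewrite ?nnegrE ?mulr_ge0 ?ltW//; lra.
by ring.
Qed.

Lemma covers_refine K e : weakly_doubling X -> 0 < e ->
  exists C rho : R, [/\ 0 < C, 0 < rho & forall r, 0 < r <= rho ->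
    forall A n, covers A (K * r) n ->
    exists2 m, covers A r m & m%:R <= n%:R * (C * r `^ (- e))].
Proof.
move=> dX e0; pose j := Num.bound `|K|.
have Kj : K <= 2 ^+ j.
  rewrite (@le_trans _ _ j%:R)//; last by rewrite -natrX ler_nat ltnW// ltn_expl.
  by rewrite (le_trans (ler_norm K))// ltW//; exact: archi_boundP.
have [C [rho [C0 rho0 H]]] := @covers_refine_exp2 j e dX e0.
exists C, rho; split=> // r r_rho A n An; apply: H => //.
apply: covers_radius An; rewrite ler_wpM2r//.
by case/andP: r_rho => /ltW.
Qed.

End Doubling.

(** * Exponents and spectra *)

Section ScaleRatio.
Set Implicit Arguments.
Unset Strict Implicit.
Context {R : realType}.
Implicit Types (theta r l e alpha : R).

Definition scale_ratio theta r := r / r `^ theta^-1.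

Lemma scale_ratio_gt0 theta r : 0 < r -> 0 < scale_ratio theta r.
Proof. by move=> r0; rewrite divr_gt0// powR_gt0. Qed.

Lemma scale_ratioM theta l r : 0 < l -> 0 < r ->
  scale_ratio theta (l * r) = scale_ratio theta l * scale_ratio theta r.
Proof. by move=> l0 r0; rewrite /scale_ratio powRM ?ltW// invfM mulrACA. Qed.

Lemma powR_scale_ratioD theta r alpha e : 0 < r ->
  scale_ratio theta r `^ (alpha + e) =
  scale_ratio theta r `^ alpha * scale_ratio theta r `^ e.
Proof. by move=> r0; rewrite powRD// (gt_eqF (scale_ratio_gt0 _ r0)) implybT. Qed.

(** Small powers of the covering radius and small powers of the ratio of the two
    radii are the same thing, because [theta < 1]. This is how the loss allowed by
    weak doubling turns into a small change of exponent. *)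
Lemma cover_radius_powR theta r e : 0 < theta -> 0 < r ->
  (r `^ theta^-1) `^ (- (e * (1 - theta))) = scale_ratio theta r `^ e.
Proof.
move=> theta0 r0; rewrite -powRrM /scale_ratio -{2}(powRr1 (ltW r0)).
rewrite -powRB; last by rewrite (gt_eqF r0) implybT.
by rewrite -powRrM; congr (_ `^ _); field; rewrite gt_eqF.
Qed.

End ScaleRatio.

Section Exponents.
Set Implicit Arguments.
Unset Strict Implicit.
Context {R : realType} {X : metricType R}.
Implicit Types (A B : set X) (theta a b r e alpha : R).

(** The spectra use [a = b = 1]; the constant factors [a] in the outer radius and
    [b] in the inner one are there to follow the distortion of balls by a
    bi-Lipschitz change of metric. *)
Definition exponent_above theta a b A alpha := exists C rho : R,
  [/\ 0 < C, 0 < rho & forall r, 0 < r <= rho -> forall x, A x ->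
    exists2 n, covers (ball x (a * r) `&` A) (b * r `^ theta^-1) n &
      n%:R <= C * scale_ratio theta r `^ alpha].

Definition exponent_below theta a b A alpha := exists C rho : R,
  [/\ 0 < C, 0 < rho & forall r, 0 < r <= rho -> forall x, A x ->
    forall n, covers (ball x (a * r) `&` A) (b * r `^ theta^-1) n ->
      C * scale_ratio theta r `^ alpha <= n%:R].

Lemma assouad_spectrumE theta A : assouad_spectrum theta A =
  ereal_inf (EFin @` [set alpha | exponent_above theta 1 1 A alpha]).
Proof.
rewrite /assouad_spectrum; congr (ereal_inf (_ @` _)).
apply/seteqP; split=> alpha [C [rho [C0 rho0 H]]];
  exists C, rho; split=> // r rr x Ax.
  by rewrite !mul1r; apply/covering_number_leP; exact: H.
by apply/covering_number_leP; have := H r rr x Ax; rewrite !mul1r.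
Qed.

Lemma lower_spectrumE theta A : lower_spectrum theta A =
  ereal_sup (EFin @` [set alpha | exponent_below theta 1 1 A alpha]).
Proof.
rewrite /lower_spectrum; congr (ereal_sup (_ @` _)).
apply/seteqP; split=> alpha [C [rho [C0 rho0 H]]];
  exists C, rho; split=> // r rr x Ax.
  by rewrite !mul1r; apply/le_covering_numberP; exact: H.
by apply/le_covering_numberP; have := H r rr x Ax; rewrite !mul1r.
Qed.

(** Two nested suprema merged into one over real exponents, so that the
    modified lower spectrum can be treated in the same way as the other two. *)
Lemma modified_lower_spectrumE theta A : modified_lower_spectrum theta A =
  ereal_sup (EFin @` [set alpha | exists2 B, B !=set0 /\ B `<=` A &
    exponent_below theta 1 1 B alpha]).
Proof.
apply/eqP; rewrite eq_le; apply/andP; split; apply/ereal_supP.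
  move=> _ [B BA <-]; rewrite lower_spectrumE.
  by apply: ereal_sup_le => _ [alpha Balpha <-]; exists alpha => //; exists B.
move=> _ [alpha [B BA Balpha] <-].
apply: (@le_trans _ _ (lower_spectrum theta B)); last first.
  by apply: ereal_sup_ubound; exists B.
by rewrite lower_spectrumE; apply: ereal_sup_ubound; exists alpha.
Qed.

(** [covers_refine] at the radii [r ^ (1 / theta)], with the loss measured in
    powers of the scale ratio. *)
Lemma covers_rescale theta b b' e : 0 < theta < 1 -> weakly_doubling X ->
  0 < b' -> 0 < e ->
  exists C rho : R, [/\ 0 < C, 0 < rho & forall r, 0 < r <= rho ->
    forall A n, covers A (b * r `^ theta^-1) n ->
    exists2 m, covers A (b' * r `^ theta^-1) m &
      m%:R <= n%:R * (C * scale_ratio theta r `^ e)].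
Proof.
move=> /andP[theta0 theta1] X_doubling b'0 e0.
have e'0 : 0 < e * (1 - theta).
  by rewrite mulr_gt0// subr_gt0.
have [C [rho [C0 rho0 H]]] := covers_refine (b / b') X_doubling e'0.
exists (C * b' `^ (- (e * (1 - theta)))), ((rho / b') `^ theta); split.
- by rewrite mulr_gt0// powR_gt0.
- by rewrite powR_gt0// divr_gt0.
move=> r /andP[r0 r_rho] A n An.
have u_rho : 0 < b' * r `^ theta^-1 <= rho.
  rewrite mulr_gt0 ?powR_gt0//= mulrC -ler_pdivlMr//.
  rewrite -[leRHS]powRr1 ?divr_ge0 ?(ltW rho0) ?(ltW b'0)//.
  rewrite -(mulfV (lt0r_neq0 theta0)) powRrM.
  by apply: ge0_ler_powR; rewrite ?nnegrE ?invr_ge0 ?powR_ge0 ?(ltW r0) ?(ltW theta0).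
have An' : covers A (b / b' * (b' * r `^ theta^-1)) n.
  by rewrite mulrA divfK// gt_eqF.
have [m Am mn] := H _ u_rho _ _ An'; exists m => //.
rewrite (le_trans mn)// powRM ?powR_ge0 ?(ltW b'0)//.
by rewrite cover_radius_powR// !mulrA.
Qed.

(** Substituting [a' / a * r] for [r] changes the outer radius [a * r] into
    [a' * r]; the inner radius and the bound change by constant factors. *)
Lemma exponent_above_outer theta a b a' A alpha : 0 < a -> 0 < a' ->
  exponent_above theta a b A alpha ->
  exponent_above theta a' (b * (a' / a) `^ theta^-1) A alpha.
Proof.
move=> a0 a'0 [C [rho [C0 rho0 H]]].
have l0 : 0 < a' / a by rewrite divr_gt0.
exists (C * scale_ratio theta (a' / a) `^ alpha), (rho / (a' / a)); split.
- by rewrite mulr_gt0// powR_gt0// scale_ratio_gt0.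
- by rewrite divr_gt0.
move=> r /andP[r0]; rewrite ler_pdivlMr// mulrC => r_rho x Ax.
have lr : 0 < a' / a * r <= rho by rewrite mulr_gt0.
have alr : a * (a' / a * r) = a' * r by field; rewrite gt_eqF.
have [n An nC] := H _ lr x Ax; exists n.
  by move: An; rewrite alr powRM ?(ltW l0) ?(ltW r0)// mulrA.
by rewrite scale_ratioM// powRM ?(ltW (scale_ratio_gt0 _ _))// mulrA in nC.
Qed.

Lemma exponent_below_outer theta a b a' A alpha : 0 < a -> 0 < a' ->
  exponent_below theta a b A alpha ->
  exponent_below theta a' (b * (a' / a) `^ theta^-1) A alpha.
Proof.
move=> a0 a'0 [C [rho [C0 rho0 H]]].
have l0 : 0 < a' / a by rewrite divr_gt0.
exists (C * scale_ratio theta (a' / a) `^ alpha), (rho / (a' / a)); split.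
- by rewrite mulr_gt0// powR_gt0// scale_ratio_gt0.
- by rewrite divr_gt0.
move=> r /andP[r0]; rewrite ler_pdivlMr// mulrC => r_rho x Ax n An.
have lr : 0 < a' / a * r <= rho by rewrite mulr_gt0.
have alr : a * (a' / a * r) = a' * r by field; rewrite gt_eqF.
have : C * scale_ratio theta (a' / a * r) `^ alpha <= n%:R.
  by apply: (H _ lr x Ax); rewrite alr powRM ?(ltW l0) ?(ltW r0)// mulrA.
by rewrite scale_ratioM// powRM ?(ltW (scale_ratio_gt0 _ _))// mulrA.
Qed.

Lemma exponent_above_rescale theta a b a' b' A alpha e :
  0 < theta < 1 -> weakly_doubling X ->
  0 < a -> 0 < b -> 0 < a' -> 0 < b' -> 0 < e ->
  exponent_above theta a b A alpha -> exponent_above theta a' b' A (alpha + e).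
Proof.
move=> theta01 X_doubling a0 b0 a'0 b'0 e0 /(exponent_above_outer a0 a'0).
set b1 := b * _; have b10 : 0 < b1 by rewrite mulr_gt0 ?powR_gt0 ?divr_gt0.
move=> [C [rho [C0 rho0 H]]].
have [C' [rho' [C'0 rho'0 H']]] := @covers_rescale _ b1 _ _ theta01 X_doubling b'0 e0.
exists (C * C'), (Num.min rho rho'); split; first by rewrite mulr_gt0.
  by rewrite lt_min rho0.
move=> r; rewrite le_min => /andP[r0 /andP[r_rho r_rho']] x Ax.
have [n An nC] := H r (introT andP (conj r0 r_rho)) x Ax.
have [m Am mn] := H' r (introT andP (conj r0 r_rho')) _ _ An.
exists m => //; rewrite (le_trans mn)// powR_scale_ratioD// mulrACA.
by rewrite ler_wpM2r// mulr_ge0 ?powR_ge0// ltW.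
Qed.

Lemma exponent_below_rescale theta a b a' b' A alpha e :
  0 < theta < 1 -> weakly_doubling X ->
  0 < a -> 0 < b -> 0 < a' -> 0 < b' -> 0 < e ->
  exponent_below theta a b A alpha -> exponent_below theta a' b' A (alpha - e).
Proof.
move=> theta01 X_doubling a0 b0 a'0 b'0 e0 /(exponent_below_outer a0 a'0).
set b1 := b * _; have b10 : 0 < b1 by rewrite mulr_gt0 ?powR_gt0 ?divr_gt0.
move=> [C [rho [C0 rho0 H]]].
have [C' [rho' [C'0 rho'0 H']]] := @covers_rescale _ b' _ _ theta01 X_doubling b10 e0.
exists (C / C'), (Num.min rho rho'); split; first by rewrite divr_gt0.
  by rewrite lt_min rho0.
move=> r; rewrite le_min => /andP[r0 /andP[r_rho r_rho']] x Ax n An.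
have [m Am mn] := H' r (introT andP (conj r0 r_rho')) _ _ An.
have mC := H r (introT andP (conj r0 r_rho)) x Ax m Am.
have s0 := scale_ratio_gt0 theta r0.
rewrite powR_scale_ratioD// powRN mulrACA -invfM ler_pdivrMr.
  exact: le_trans mC mn.
by rewrite mulr_gt0// powR_gt0.
Qed.

Lemma exponent_below0 theta A : exponent_below theta 1 1 A 0.
Proof.
exists 1, 1; split=> // r /andP[r0 _] x Ax n.
rewrite powRr0 mulr1 ler1n; apply: (covers_gt0 (x := x)); split=> //.
by rewrite mul1r; exact: ballxx.
Qed.

(** A negative exponent would make the bound on the number of balls tend to [0]
    with [r], whereas at least one ball is always needed. *)
Lemma exponent_above_ge0 theta A alpha : 0 < theta < 1 -> A !=set0 ->
  exponent_above theta 1 1 A alpha -> 0 <= alpha.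
Proof.
move=> /andP[theta0 theta1] [x Ax] [C [rho [C0 rho0 H]]].
rewrite leNgt; apply/negP => alpha0.
pose delta := theta^-1 * - (alpha * (1 - theta)).
have delta0 : 0 < delta.
  by rewrite mulr_gt0 ?invr_gt0// -mulNr mulr_gt0 ?oppr_gt0// subr_gt0.
(* At [r1] the bound [C * r ^ delta] on the number of balls equals [1 / 2]. *)
pose r1 := ((2 * C)^-1) `^ delta^-1.
have r10 : 0 < r1 by rewrite powR_gt0// invr_gt0 mulr_gt0.
have r0 : 0 < Num.min rho r1 by rewrite lt_min rho0.
have r_rho : 0 < Num.min rho r1 <= rho by rewrite r0 ge_min lexx.
have [n An nC] := H _ r_rho x Ax.
have : (0 < n)%N.
  apply: (covers_gt0 (x := x) _ An); split=> //.
  by rewrite mul1r; exact: ballxx.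
apply/negP; rewrite -leqNgt leqn0 -(@pnatr_eq0 R); apply: contraTT nC => n0.
rewrite -ltNge (@lt_le_trans _ _ 1)//; last first.
  by rewrite ler1n lt0n; apply: contraNneq n0 => ->.
rewrite -cover_radius_powR// -powRrM -/delta.
apply: (@le_lt_trans _ _ (C * r1 `^ delta)).
  rewrite ler_wpM2l ?(ltW C0)//; apply: ge0_ler_powR.
  - exact: ltW.
  - by rewrite nnegrE ltW.
  - by rewrite nnegrE ltW.
  - by rewrite ge_min lexx orbT.
rewrite /r1 -powRrM mulVf ?gt_eqF// powRr1; last first.
  by rewrite invr_ge0 mulr_ge0// ltW.
by rewrite invfM mulrCA divff ?gt_eqF// mulr1 invf_lt1// ltr1n.
Qed.

Lemma lower_spectrum_ge0 theta A : (0 <= lower_spectrum theta A)%E.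
Proof.
rewrite lower_spectrumE; apply: ereal_sup_ubound.
by exists 0 => //; exact: exponent_below0.
Qed.

Lemma assouad_spectrum_ge0 theta A : 0 < theta < 1 -> A !=set0 ->
  (0 <= assouad_spectrum theta A)%E.
Proof.
move=> theta01 A0; rewrite assouad_spectrumE; apply/ereal_infP.
by move=> _ [alpha /(exponent_above_ge0 theta01 A0)? <-]; rewrite lee_fin.
Qed.

Lemma lower_le_modified_lower_spectrum theta A B : B !=set0 -> B `<=` A ->
  (lower_spectrum theta B <= modified_lower_spectrum theta A)%E.
Proof. by move=> B0 BA; apply: ereal_sup_ubound; exists B. Qed.

Lemma assouad_spectrum_le theta A alpha :
  (forall e, 0 < e -> exponent_above theta 1 1 A (alpha + e)) ->
  (assouad_spectrum theta A <= alpha%:E)%E.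
Proof.
move=> H; apply/lee_addgt0Pr => e e0; rewrite assouad_spectrumE -EFinD.
by apply: ereal_inf_lbound; exists (alpha + e) => //; exact: H.
Qed.

Lemma le_lower_spectrum theta A alpha :
  (forall e, 0 < e -> exponent_below theta 1 1 A (alpha - e)) ->
  (alpha%:E <= lower_spectrum theta A)%E.
Proof.
move=> H; apply/lee_addgt0Pr => e e0; rewrite lower_spectrumE -leeBlDr//.
by apply: ereal_sup_ubound; exists (alpha - e) => //; exact: H.
Qed.

End Exponents.

(** * Covers of products *)

Section Product.
Set Implicit Arguments.
Unset Strict Implicit.
Context {R : realType}.

(** Greedy choice of points of [A] at mutual distance at least [2 * u]: the
    entries [c] of [s] with [f c] within [u] of a chosen point [x] yield a cover
    of [B], so each choice uses up at least [q] entries, and an entry cannot serve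
    two chosen points. The list [s] is indexed by an arbitrary type so that the
    roles of the two factors of a product can be exchanged. *)
Lemma covers_factor (E F : metricType R) (T : eqType) (f : T -> E)
    (g : T -> F) (u v q : R) (A : set E) (B : set F) (s : seq T) : 0 < q ->
  (forall m, covers B v m -> q <= m%:R) ->
  (forall x y, A x -> B y ->
    exists2 c, c \in s & ball (f c) u x /\ ball (g c) v y) ->
  exists2 k, covers A (2 * u) k & k%:R * q <= (size s)%:R.
Proof.
move=> q0 Bq.
have [n] := ubnP (size s); elim: n A s => // n IHn A s sn As.
have [->|/set0P[x Ax]] := eqVneq A set0.
  by exists 0%N; [exists [::] | rewrite mul0r].
pose near_x := [pred c | `[< ball (f c) u x >]].
have q_near : q <= (count near_x s)%:R.
  apply: Bq; exists (map g [seq o <- s | near_x o]).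
    by rewrite size_map size_filter.
  move=> y By; have [c cs [cx cy]] := As x y Ax By; exists (g c) => //.
  by rewrite map_f// mem_filter cs andbT; exact/asboolP.
have near_gt0 : (0 < count near_x s)%N by rewrite -(ltr0n R) (lt_le_trans q0).
have s_count : (count near_x s + size [seq o <- s | predC near_x o] = size s)%N.
  by rewrite size_filter count_predC.
have [|x' y [Ax' xx'] By|k [t tk At] kq] :=
    IHn (A `\` ball x (2 * u)) [seq o <- s | predC near_x o].
- by rewrite -ltnS (leq_trans _ sn)// ltnS -s_count -[ltnLHS]add0n ltn_add2r.
(* A ball meeting both fibres would put [x'] within [2 * u] of [x]. *)
- have [c cs [cx' cy]] := As x' y Ax' By; exists c => //.
  rewrite mem_filter cs andbT; apply/asboolPn => cx; apply: xx'.
  by rewrite mulr_natl mulr2n; exact: ball_triangle (ball_sym cx) cx'.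
exists k.+1.
  exists (x :: t) => // x' Ax'.
  have [xx'|xx'] := pselect (ball x (2 * u) x').
    by exists x => //; rewrite mem_head.
  have [c ct cx'] := At x' (conj Ax' xx').
  by exists c => //; rewrite in_cons ct orbT.
by rewrite -s_count natrD -nat1r mulrDl mul1r lerD.
Qed.

Context {E F : metricType R} {d : E * F -> E * F -> R}
  (hd : suitable_product_metric d).
Notation EF := (metric_prod hd).

Implicit Types (W : set EF) (A : set E) (B : set F).

(** The bi-Lipschitz condition in the only form used below: up to the factor
    [c], balls of the product are products of balls. *)
Lemma product_balls : exists2 c : R, 0 < c & forall (p q : EF) (t : R),
  (ball p t q -> ball p.1 (c * t) q.1 /\ ball p.2 (c * t) q.2) /\
  (ball p.1 t q.1 -> ball p.2 t q.2 -> ball p (c * t) q).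
Proof.
have [c c0 dc] := spm_bilipschitz hd; exists c => // p q t.
rewrite !ballEmdist /=.
change (mdist p q) with (d p q).
have /andP[cd dcs] := dc p q; split=> [dt|p1 p2].
  have : sup_dist p q < c * t.
    by rewrite -ltr_pdivrMl// (le_lt_trans cd).
  by rewrite /sup_dist gt_max => /andP[].
by rewrite (le_lt_trans dcs)// ltr_pM2l// /sup_dist gt_max p1.
Qed.

Section Constant.
Variable c : R.
Hypothesis c0 : 0 < c.
Hypothesis cP : forall (p q : EF) (t : R),
  (ball p t q -> ball p.1 (c * t) q.1 /\ ball p.2 (c * t) q.2) /\
  (ball p.1 t q.1 -> ball p.2 t q.2 -> ball p (c * t) q).

Lemma covers_product W A B u n m :
  (forall p : EF, W p -> A p.1 /\ B p.2) ->
  covers A u n -> covers B u m -> covers W (c * u) (n * m).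
Proof.
move=> WAB [s sn As] [t tm Bt].
exists ([seq (x, y) | x <- s, y <- t] : seq EF).
  by rewrite size_allpairs leq_mul.
move=> p /WAB[/As[x xs xp] /Bt[y yt yp]]; exists ((x, y) : EF).
  by apply/allpairsP; exists (x, y).
exact: (cP _ _ _).2.
Qed.

Lemma covers_product_ball (p : EF) W A B r u n m :
  (forall p : EF, W p -> A p.1 /\ B p.2) ->
  covers (ball p.1 (c * r) `&` A) (c^-1 * u) n ->
  covers (ball p.2 (c * r) `&` B) (c^-1 * u) m ->
  covers (ball p (1 * r) `&` W) (1 * u) (n * m).
Proof.
move=> WAB An Bm; rewrite !mul1r -[u](mulVKf (lt0r_neq0 c0)).
by apply: covers_product An Bm => q [/(cP _ _ _).1[q1 q2] /WAB[]].
Qed.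

Lemma covers_product_factor (p : EF) W A B r u (s : seq EF) :
  (forall x y, A x -> B y -> W (x, y)) ->
  (forall q : EF, (ball p (1 * r) `&` W) q ->
    exists2 o, o \in s & ball o (1 * u) q) ->
  forall x y, (ball p.1 (c^-1 * r) `&` A) x -> (ball p.2 (c^-1 * r) `&` B) y ->
  exists2 o : EF, o \in s & ball o.1 (c * u) x /\ ball o.2 (c * u) y.
Proof.
rewrite !mul1r => ABW Ws x y [px Ax] [py By].
have [|o os oxy] := Ws (x, y).
  split; last exact: ABW.
  by rewrite -[r](mulVKf (lt0r_neq0 c0)); exact: (cP _ _ _).2.
by exists o => //; exact: ((cP _ _ _).1 oxy).
Qed.

Section Exponents.
Variable theta : R.

(** The next four lemmas divide or multiply the bounds given by
    [covers_product_ball] and [covers_product_factor]. The factors [a] and [b]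
    are those produced by these two comparisons. *)
Lemma exponent_above_product W A B alpha beta :
  (forall p : EF, W p -> A p.1 /\ B p.2) ->
  exponent_above theta c c^-1 A alpha -> exponent_above theta c c^-1 B beta ->
  exponent_above theta 1 1 W (alpha + beta).
Proof.
move=> WAB [C1 [rho1 [C10 rho10 H1]]] [C2 [rho2 [C20 rho20 H2]]].
exists (C1 * C2), (Num.min rho1 rho2); split; rewrite ?mulr_gt0 ?lt_min ?rho10//.
move=> r; rewrite le_min => /andP[r0 /andP[r1 r2]] p /[dup] Wp /WAB[Ap Bp].
have [n An nC] := H1 r (introT andP (conj r0 r1)) _ Ap.
have [m Bm mC] := H2 r (introT andP (conj r0 r2)) _ Bp.
exists (n * m)%N; first exact: covers_product_ball WAB An Bm.
by rewrite natrM powR_scale_ratioD// mulrACA ler_pM.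
Qed.

Lemma exponent_below_proj W A B gamma beta :
  (forall p : EF, W p -> A p.1 /\ B p.2) ->
  (forall x, A x -> exists y, W (x, y)) ->
  exponent_below theta 1 1 W gamma -> exponent_above theta c c^-1 B beta ->
  exponent_below theta c c^-1 A (gamma - beta).
Proof.
move=> WAB AW [C1 [rho1 [C10 rho10 H1]]] [C2 [rho2 [C20 rho20 H2]]].
exists (C1 / C2), (Num.min rho1 rho2); split; rewrite ?divr_gt0 ?lt_min ?rho10//.
move=> r; rewrite le_min => /andP[r0 /andP[r1 r2]] x Ax n An.
have [y Wxy] := AW x Ax; have [_ By] := WAB _ Wxy.
have [m Bm mC] := H2 r (introT andP (conj r0 r2)) _ By.
have := H1 r (introT andP (conj r0 r1)) _ Wxy _
  (@covers_product_ball (x, y) _ _ _ _ _ _ _ WAB An Bm).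
have s0 := scale_ratio_gt0 theta r0.
rewrite natrM powR_scale_ratioD// powRN mulrACA -invfM => Cnm.
rewrite ler_pdivrMr; last by rewrite mulr_gt0// powR_gt0.
by rewrite (le_trans Cnm)// ler_wpM2l.
Qed.

Lemma exponent_below_product W A B alpha beta :
  (forall x y, A x -> B y -> W (x, y)) ->
  (forall p : EF, W p -> A p.1 /\ B p.2) ->
  exponent_below theta c^-1 (2 * c) A alpha ->
  exponent_below theta c^-1 c B beta ->
  exponent_below theta 1 1 W (alpha + beta).
Proof.
move=> ABW WAB [C1 [rho1 [C10 rho10 H1]]] [C2 [rho2 [C20 rho20 H2]]].
exists (C1 * C2), (Num.min rho1 rho2); split; rewrite ?mulr_gt0 ?lt_min ?rho10//.
move=> r; rewrite le_min => /andP[r0 /andP[r1 r2]] p /WAB[Ap Bp] n [s sn Ws].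
have s0 := scale_ratio_gt0 theta r0.
have q0 : 0 < C2 * scale_ratio theta r `^ beta by rewrite mulr_gt0// powR_gt0.
have [k Ak ks] := covers_factor q0 (H2 r (introT andP (conj r0 r2)) _ Bp)
  (covers_product_factor ABW Ws).
rewrite mulrA in Ak.
rewrite (@le_trans _ _ (size s)%:R) ?ler_nat// (le_trans _ ks)//.
rewrite powR_scale_ratioD// mulrACA ler_wpM2r ?(ltW q0)//.
exact: H1 (introT andP (conj r0 r1)) _ Ap _ Ak.
Qed.

(** The ball of the product is taken around a point above a fixed [x] in [A];
    one such point is enough because the lower exponent of [A] is uniform. *)
Lemma exponent_above_factor W A B gamma alpha : A !=set0 ->
  (forall x y, A x -> B y -> W (x, y)) ->
  exponent_above theta 1 1 W gamma -> exponent_below theta c^-1 c A alpha ->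
  exponent_above theta c^-1 (2 * c) B (gamma - alpha).
Proof.
move=> [x Ax] ABW [C1 [rho1 [C10 rho10 H1]]] [C2 [rho2 [C20 rho20 H2]]].
exists (C1 / C2), (Num.min rho1 rho2); split; rewrite ?divr_gt0 ?lt_min ?rho10//.
move=> r; rewrite le_min => /andP[r0 /andP[r1 r2]] y By.
have s0 := scale_ratio_gt0 theta r0.
have [n [s sn Ws] nC] := H1 r (introT andP (conj r0 r1)) _ (ABW _ _ Ax By).
have q0 : 0 < C2 * scale_ratio theta r `^ alpha by rewrite mulr_gt0// powR_gt0.
have [k Bk ks] : exists2 k,
    covers (ball y (c^-1 * r) `&` B) (2 * (c * r `^ theta^-1)) k &
    k%:R * (C2 * scale_ratio theta r `^ alpha) <= (size s)%:R.
  apply: (covers_factor (f := snd : EF -> F) (g := fst : EF -> E) q0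
    (H2 r (introT andP (conj r0 r2)) _ Ax)) => y' x' By' Ax'.
  have [p ps [px py]] := covers_product_factor ABW Ws Ax' By'.
  by exists p.
exists k; first by rewrite -mulrA.
rewrite powR_scale_ratioD// powRN mulrACA -invfM ler_pdivlMr//.
by rewrite (le_trans ks)// (le_trans _ nC)// ler_nat.
Qed.

End Exponents.
End Constant.

(** Returning to the factors [a = b = 1] before and after the product
    comparison costs [e / 2] each time, and this disappears in the spectrum. *)
Section Bounds.
Variable theta : R.
Hypotheses (theta01 : 0 < theta < 1).
Hypotheses (E_doubling : weakly_doubling E) (F_doubling : weakly_doubling F).

Lemma assouad_spectrum_product_le W A B alpha beta :
  (forall p : EF, W p -> A p.1 /\ B p.2) ->
  exponent_above theta 1 1 A alpha -> exponent_above theta 1 1 B beta ->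
  (assouad_spectrum theta W <= (alpha + beta)%:E)%E.
Proof.
move=> WAB Aalpha Bbeta; apply: assouad_spectrum_le => e e0.
have e20 : 0 < e / 2 by rewrite divr_gt0.
have [c c0 cP] := product_balls.
have ci0 : 0 < c^-1 by rewrite invr_gt0.
have -> : alpha + beta + e = (alpha + e / 2) + (beta + e / 2) by field.
apply: (exponent_above_product c0 cP WAB).
- exact: exponent_above_rescale Aalpha.
- exact: exponent_above_rescale Bbeta.
Qed.

Lemma lower_spectrum_product_ge W A B alpha beta :
  (forall x y, A x -> B y -> W (x, y)) ->
  (forall p : EF, W p -> A p.1 /\ B p.2) ->
  exponent_below theta 1 1 A alpha -> exponent_below theta 1 1 B beta ->
  ((alpha + beta)%:E <= lower_spectrum theta W)%E.
Proof.
move=> ABW WAB Aalpha Bbeta; apply: le_lower_spectrum => e e0.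
have e20 : 0 < e / 2 by rewrite divr_gt0.
have [c c0 cP] := product_balls.
have ci0 : 0 < c^-1 by rewrite invr_gt0.
have c20 : 0 < 2 * c by rewrite mulr_gt0.
have -> : alpha + beta - e = (alpha - e / 2) + (beta - e / 2) by field.
apply: (exponent_below_product c0 cP ABW WAB).
- exact: exponent_below_rescale Aalpha.
- exact: exponent_below_rescale Bbeta.
Qed.

Lemma lower_spectrum_proj_ge W A B gamma beta :
  (forall p : EF, W p -> A p.1 /\ B p.2) ->
  (forall x, A x -> exists y, W (x, y)) ->
  exponent_below theta 1 1 W gamma -> exponent_above theta 1 1 B beta ->
  ((gamma - beta)%:E <= lower_spectrum theta A)%E.
Proof.
move=> WAB AW Wgamma Bbeta; apply: le_lower_spectrum => e e0.
have e20 : 0 < e / 2 by rewrite divr_gt0.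
have [c c0 cP] := product_balls.
have ci0 : 0 < c^-1 by rewrite invr_gt0.
have -> : gamma - beta - e = (gamma - (beta + e / 2)) - e / 2 by field.
apply: (@exponent_below_rescale _ _ _ c c^-1) => //.
apply: (exponent_below_proj c0 cP WAB AW Wgamma).
exact: exponent_above_rescale Bbeta.
Qed.

Lemma assouad_spectrum_le_factor W A B gamma alpha : A !=set0 ->
  (forall x y, A x -> B y -> W (x, y)) ->
  exponent_above theta 1 1 W gamma -> exponent_below theta 1 1 A alpha ->
  (assouad_spectrum theta B <= (gamma - alpha)%:E)%E.
Proof.
move=> A0 ABW Wgamma Aalpha; apply: assouad_spectrum_le => e e0.
have e20 : 0 < e / 2 by rewrite divr_gt0.
have [c c0 cP] := product_balls.
have ci0 : 0 < c^-1 by rewrite invr_gt0.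
have c20 : 0 < 2 * c by rewrite mulr_gt0.
have -> : gamma - alpha + e = (gamma - (alpha - e / 2)) + e / 2 by field.
apply: (@exponent_above_rescale _ _ _ c^-1 (2 * c)) => //.
apply: (exponent_above_factor c0 cP A0 ABW Wgamma).
exact: exponent_below_rescale Aalpha.
Qed.

End Bounds.

End Product.

(** * Suprema and infima of sums in the extended reals *)

Section ExtendedReals.
Set Implicit Arguments.
Unset Strict Implicit.
Context {R : realType}.
Implicit Types (S : set R) (y z : \bar R).
Local Open Scope ereal_scope.

(** As [+oo + -oo = -oo], the sum is [-oo] whenever
    [S] is empty or [y = -oo]. *)
Lemma ereal_sup_EFinD_le S y z :
  (forall a, S a -> a%:E + y <= z) -> ereal_sup (EFin @` S) + y <= z.
Proof.
case: y => [y| |] Sz; last by rewrite addeNy leNye.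
  rewrite -leeBrDr//; apply/ereal_supP => _ [a Sa <-].
  by rewrite leeBrDr// Sz.
have [->|/set0P[a Sa]] := eqVneq S set0.
  by rewrite image_set0 ereal_sup0 addNye leNye.
by move: (Sz a Sa); rewrite addey// leye_eq => /eqP->; rewrite leey.
Qed.

(** The sign conditions exclude [+oo + -oo = -oo], for which the conclusion may
    fail. *)
Lemma le_ereal_inf_EFinD S y z : 0 <= y -> (forall b, S b -> (0 <= b)%R) ->
  (forall b, S b -> z <= y + b%:E) -> z <= y + ereal_inf (EFin @` S).
Proof.
move=> y0 S0 Sz; case: y y0 Sz => [y y0 Sz| _ _|]//.
  rewrite addeC -leeBlDr//; apply/ereal_infP => _ [b Sb <-].
  by rewrite leeBlDr// addeC Sz.
rewrite addye ?leey// gt_eqF// (@lt_le_trans _ _ 0)//.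
by apply/ereal_infP => _ [b Sb <-]; rewrite lee_fin S0.
Qed.

End ExtendedReals.

(** * The product inequalities *)

Theorem proposition4p4 (R : realType) (E F : metricType R)
    (E_neq0 : [set: E] !=set0) (F_neq0 : [set: F] !=set0)
    (E_doubling : weakly_doubling E) (F_doubling : weakly_doubling F)
    (d : E * F -> E * F -> R) (hd : suitable_product_metric d)
    (theta : R) (theta01 : 0 < theta < 1) :
  [/\ (modified_lower_spectrum theta [set: E] + assouad_spectrum theta [set: F]
         <= assouad_spectrum theta [set: metric_prod hd]
         <= assouad_spectrum theta [set: E] + assouad_spectrum theta [set: F])%E,
      (lower_spectrum theta [set: E] + lower_spectrum theta [set: F]
         <= lower_spectrum theta [set: metric_prod hd]
         <= lower_spectrum theta [set: E] + assouad_spectrum theta [set: F])%E &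
      (modified_lower_spectrum theta [set: E]
           + modified_lower_spectrum theta [set: F]
         <= modified_lower_spectrum theta [set: metric_prod hd]
         <= modified_lower_spectrum theta [set: E]
              + assouad_spectrum theta [set: F])%E].
Proof.
have F_above_ge0 beta : exponent_above theta 1 1 [set: F] beta -> 0 <= beta.
  exact: exponent_above_ge0.
have ML_ge0 : (0 <= modified_lower_spectrum theta [set: E])%E.
  exact: le_trans (lower_spectrum_ge0 _ _)
    (lower_le_modified_lower_spectrum theta E_neq0 (@subsetT _ _)).
split; apply/andP; split.
- rewrite modified_lower_spectrumE [leRHS]assouad_spectrumE.
  apply/ereal_infP => _ [gamma EFgamma <-].
  apply: ereal_sup_EFinD_le => alpha [G [G0 _] Galpha].
  rewrite addeC -leeBrDr// -EFinB.
  exact: (assouad_spectrum_le_factor theta01 E_doubling F_doubling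
    G0 _ EFgamma Galpha).
- rewrite [X in (_ <= _ + X)%E]assouad_spectrumE.
  apply: le_ereal_inf_EFinD => [|//|beta Fbeta]; first exact: assouad_spectrum_ge0.
  rewrite assouad_spectrumE addeC [X in (_ <= _ + X)%E]assouad_spectrumE.
  apply: le_ereal_inf_EFinD => [|alpha|alpha Ealpha].
  - by rewrite lee_fin F_above_ge0.
  - exact: exponent_above_ge0.
  rewrite addeC -EFinD -assouad_spectrumE.
  exact: (assouad_spectrum_product_le theta01 E_doubling F_doubling
    _ Ealpha Fbeta).
- rewrite lower_spectrumE; apply: ereal_sup_EFinD_le => alpha Ealpha.
  rewrite addeC lower_spectrumE; apply: ereal_sup_EFinD_le => beta Fbeta.
  rewrite addeC -EFinD.
  exact: (lower_spectrum_product_ge theta01 E_doubling F_doubling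
    _ _ Ealpha Fbeta).
- rewrite assouad_spectrumE; apply: le_ereal_inf_EFinD => [|//|beta Fbeta].
    exact: lower_spectrum_ge0.
  rewrite [leLHS]lower_spectrumE; apply/ereal_supP => _ [gamma EFgamma <-].
  rewrite -leeBlDr// -EFinB.
  apply: (lower_spectrum_proj_ge theta01 E_doubling F_doubling
    _ _ EFgamma Fbeta) => //.
- rewrite modified_lower_spectrumE.
  apply: ereal_sup_EFinD_le => alpha [G [G0 _] Galpha].
  rewrite addeC modified_lower_spectrumE.
  apply: ereal_sup_EFinD_le => beta [H [H0 _] Hbeta]; rewrite addeC -EFinD.
  pose W : set (metric_prod hd) := [set p | G p.1 /\ H p.2].
  apply: (@le_trans _ _ (lower_spectrum theta W)).
    exact: (lower_spectrum_product_ge theta01 E_doubling F_doubling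
      _ _ Galpha Hbeta).
  apply: lower_le_modified_lower_spectrum => //.
  by have [[x Gx] [y Hy]] := (G0, H0); exists (x, y).
- rewrite assouad_spectrumE; apply: le_ereal_inf_EFinD => [//|//|beta Fbeta].
  rewrite [leLHS]modified_lower_spectrumE.
  apply/ereal_supP => _ [gamma [W [[p Wp] _] Wgamma] <-].
  rewrite -leeBlDr// -EFinB.
  (* The projection of [W] is the subset of [E] that competes in the supremum. *)
  pose G := [set x | exists y, W (x, y)].
  apply: (@le_trans _ _ (lower_spectrum theta G)).
    apply: (lower_spectrum_proj_ge theta01 E_doubling F_doubling
      _ _ Wgamma Fbeta) => //.
    by move=> [x y] Wxy; split => //; exists y.
  apply: lower_le_modified_lower_spectrum => //.
  by exists p.1, p.2; case: p Wp.
Qed.
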